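(* Fix an integer $d \ge 2$. Then the family of random variables $\{V_n\}_{n=1}^\infty$ is tight. Moreover, there is a constant $c>0$ such that for all sufficiently large integers $k$, $$\sup_{n} \mathbb{P}(|V_n| \ge 2k) \le e^{-c d^k}.$$
   Context: $\mathbb{T}_d$ is the infinite rooted $d$-ary tree (every vertex has exactly $d$ children), with root $\rho$. The height $|v|$ of a vertex is its distance from $\rho$; $v$ is even (odd) if $|v|$ is even (odd). $N(v)$ is the set of children of $v$. Each edge $e$ carries a cookie $X_e$, where the $X_e$ are i.i.d. uniform on $\{-1,+1\}$; for an edge between $v$ and its child $u$ we write $X_{uv}$. For $n\ge 0$ and vertices $v$ with $|v|\le 2n$, define $V_n(v)=0$ if $|v|=2n$, and for $|v|<2n$ recursively $$V_n(v)=\max\{X_{uv}+V_n(u): u\in N(v)\}\ (v \text{ even}),\qquad V_n(v)=\min\{X_{uv}+V_n(u): u\in N(v)\}\ (v\text{ odd}).$$ $V_n:=V_n(\rho)$ is the value of the $n$-round zero-sum game in which, starting from the root, a maximizing player (first) and a minimizing player alternately move to a child until level $2n$, the payoff being the sum of the cookies along the path, with full information. *)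

(* Defs.v *)
From HB Require Import structures.
From mathcomp Require Import all_boot all_order all_algebra.
From mathcomp Require Import all_classical all_reals all_analysis.
From mathcomp Require Import measurable_realfun.

Set Implicit Arguments.
Unset Strict Implicit.
Unset Printing Implicit Defensive.

Import Order.TTheory GRing.Theory Num.Theory.
Import numFieldNormedType.Exports.

Local Open Scope classical_set_scope.
Local Open Scope ring_scope.

(* A vertex of the infinite rooted d-ary tree is the word of child labels read
   along the path from the root; the pair (v, i) encodes the edge joining v to
   its i-th child, so that every edge is encoded exactly once. *)
Definition vertex (d : nat) := seq 'I_d.
Definition edge (d : nat) := (vertex d * 'I_d)%type.
Definition root (d : nat) : vertex d := [::].
Definition height (d : nat) (v : vertex d) : nat := size v.
Definition child (d : nat) (v : vertex d) (i : 'I_d) : vertex d := rcons v i.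

(* The default value 0 only serves the degenerate case d = 0; for d > 0 these
   are the true maximum and minimum, see max_overP and min_overP. *)
Definition max_over (R : realType) (d : nat) : ('I_d -> R) -> R :=
  match d with
  | 0%N => fun=> 0
  | d'.+1 => fun F => \big[Num.max/F ord0]_(i < d'.+1) F i
  end.

Definition min_over (R : realType) (d : nat) : ('I_d -> R) -> R :=
  match d with
  | 0%N => fun=> 0
  | d'.+1 => fun F => \big[Num.min/F ord0]_(i < d'.+1) F i
  end.

Lemma max_overP (R : realType) (d : nat) (F : 'I_d -> R) : (0 < d)%N ->
  (exists i, max_over F = F i) /\ (forall i, F i <= max_over F).
Proof.
case: d F => // d F _; split; last by move=> i; exact: le_bigmax.
rewrite /max_over; elim/big_ind: _ => [|x y [i ->] [j ->]|i _].
- by exists ord0.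
- by case: (leP (F i) (F j)) => _; [exists j|exists i].
- by exists i.
Qed.

Lemma min_overP (R : realType) (d : nat) (F : 'I_d -> R) : (0 < d)%N ->
  (exists i, min_over F = F i) /\ (forall i, min_over F <= F i).
Proof.
case: d F => // d F _; split; last by move=> i; exact: bigmin_le.
rewrite /min_over; elim/big_ind: _ => [|x y [i ->] [j ->]|i _].
- by exists ord0.
- by case: (leP (F i) (F j)) => _; [exists i|exists j].
- by exists i.
Qed.

Section GameValue.
Variables (R : realType) (d : nat).

(* m is the number of moves left before the game ends. *)
Fixpoint value_rec (x : edge d -> R) (m : nat) (v : vertex d) : R :=
  match m with
  | 0%N => 0
  | m'.+1 =>
      if odd (height v)
      then min_over (fun i => x (v, i) + value_rec x m' (child v i))
      else max_over (fun i => x (v, i) + value_rec x m' (child v i))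
  end.

Definition value_at (x : edge d -> R) (n : nat) (v : vertex d) : R :=
  value_rec x (2 * n - height v) v.

Lemma value_at_leaf x n v : height v = (2 * n)%N -> value_at x n v = 0.
Proof. by rewrite /value_at => ->; rewrite subnn. Qed.

Lemma value_at_even x n v : (height v < 2 * n)%N -> ~~ odd (height v) ->
  value_at x n v = max_over (fun i => x (v, i) + value_at x n (child v i)).
Proof.
move=> vn /negbTE ev; rewrite /value_at -[in LHS](prednK (n := 2 * n - _)) ?subn_gt0//= ev.
congr max_over; apply/funext => i.
by rewrite /child /height size_rcons subnS.
Qed.

Lemma value_at_odd x n v : (height v < 2 * n)%N -> odd (height v) ->
  value_at x n v = min_over (fun i => x (v, i) + value_at x n (child v i)).
Proof.
move=> vn ov; rewrite /value_at -[in LHS](prednK (n := 2 * n - _)) ?subn_gt0//= ov.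
congr min_over; apply/funext => i.
by rewrite /child /height size_rcons subnS.
Qed.

End GameValue.

Section Probability.
Context (dT : measure_display) (T : measurableType dT) (R : realType).
Variable P : probability T R.

Definition mutually_independent (I : eqType) (X : I -> {RV P >-> R}) : Prop :=
  forall (s : seq I) (A : I -> set R), uniq s ->
    (forall i, measurable (A i)) ->
    P (\bigcap_(i in [set` s]) (X i @^-1` A i)) =
    (\prod_(i <- s) P (X i @^-1` A i))%E.

Definition uniform_sign (X : {RV P >-> R}) : Prop :=
  P (X @^-1` [set 1]) = (2^-1)%:E /\ P (X @^-1` [set -1]) = (2^-1)%:E.

Definition tight (I : Type) (D : set I) (Y : I -> {RV P >-> R}) : Prop :=
  forall eps : R, 0 < eps ->
    exists K : set R, compact K /\
      forall i, D i -> ((1 - eps)%:E <= distribution P (Y i) K)%E.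

Definition game_value (d : nat) (X : edge d -> {RV P >-> R}) (n : nat) :
  T -> R := fun w => value_at (fun e => X e w) n (root d).

Lemma measurable_game_value (d : nat) (X : edge d -> {RV P >-> R}) n :
  measurable_fun setT (game_value X n).
Proof.
suff mV m v : measurable_fun setT (fun w => value_rec (fun e => X e w) m v).
  exact: mV.
elim: m v => [|m IH] v.
  exact: measurable_cst.
have mF i : measurable_fun setT
    (fun w => X (v, i) w + value_rec (fun e => X e w) m (child v i)).
  by apply: measurable_funD => //; exact: IH.
move: mF => /=; case: (odd _) => mF.
- case: d X v {IH} mF => [|d'] X v mF; first exact: measurable_cst.
  rewrite /min_over; elim: (index_enum _) => [|i s IHs].
    by under eq_fun do rewrite big_nil; exact: mF.
  by under eq_fun do rewrite big_cons; exact: measurable_minr.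
- case: d X v {IH} mF => [|d'] X v mF; first exact: measurable_cst.
  rewrite /max_over; elim: (index_enum _) => [|i s IHs].
    by under eq_fun do rewrite big_nil; exact: mF.
  by under eq_fun do rewrite big_cons; exact: measurable_maxr.
Qed.

HB.instance Definition _ d (X : edge d -> {RV P >-> R}) n :=
  isMeasurableFun.Build _ _ _ _ (game_value X n) (measurable_game_value X n).

Definition V (d : nat) (X : edge d -> {RV P >-> R}) (n : nat) : {RV P >-> R} :=
  game_value X n.

End Probability.

(* Main.v *)
Require Import Defs.
From mathcomp Require Import all_boot all_order all_algebra.
From mathcomp Require Import all_classical all_reals all_analysis.
From mathcomp Require Import ring lra zify.

Import Order.TTheory GRing.Theory Num.Theory.
Import numFieldNormedType.Exports.

Local Open Scope classical_set_scope.
Local Open Scope ring_scope.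

(** By independence, P(V_n >= t) obeys a monotone recursion in n. Once
    d P(V_n >= 2K) <= 1/2 uniformly in n, a union bound over the children turns the
    recursion into p_(n+1)(t + 2) <= d p_n(t)^d, hence into the doubly exponential tail;
    the lower tail follows because the minimizer's game is the negated one. So everything
    rests on an upper barrier for the recursion that starts above the step function 1_(t <= 0).

    For d >= 3 there is a stationary barrier. For d = 2 the recursion is only marginally
    stable: it has a continuous family of stationary profiles, and the barrier has to move.
    The profiles are explicit: they are 1 - z_j^2 with z_(j+1)^2 = 2 z_j - z_j^2. The solution
    started from the step function equals 1 up to a site moving left at speed one.
    Cutting a stationary profile off there costs a doubly exponentially small change of its
    parameter per round, so the barrier moves by a bounded amount in total. *)

(** * The recursion for the tails *)

Section Tail.
Variables (R : realType) (d : nat).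

(* [tail true m t] is the probability that an [m]-move game opened by the
   maximizer has value at least [t]; [tail false] is for a game opened by the
   minimizer. *)
Fixpoint tail (mx : bool) (m : nat) (t : R) : R :=
  match m with
  | 0%N => (t <= 0)%R%:R
  | m'.+1 =>
      if mx then 1 - (1 - (tail false m' (t - 1) + tail false m' (t + 1)) / 2) ^+ d
      else ((tail true m' (t - 1) + tail true m' (t + 1)) / 2) ^+ d
  end.

Lemma tail_itv mx m t : 0 <= tail mx m t <= 1.
Proof.
elim: m mx t => [|m IH] [] t /=; do ?by case: (t <= 0); rewrite lexx ler01.
  have /andP[? ?] := IH false (t - 1); have /andP[? ?] := IH false (t + 1).
  rewrite subr_ge0 gerBl exprn_ge0 ?exprn_ile1 //; lra.
have /andP[? ?] := IH true (t - 1); have /andP[? ?] := IH true (t + 1).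
rewrite exprn_ge0 ?exprn_ile1 //; lra.
Qed.

Lemma tail_ge0 mx m t : 0 <= tail mx m t.
Proof. by case/andP: (tail_itv mx m t). Qed.

Lemma tail_le1 mx m t : tail mx m t <= 1.
Proof. by case/andP: (tail_itv mx m t). Qed.

Lemma le_tail mx m s t : s <= t -> tail mx m t <= tail mx m s.
Proof.
elim: m mx s t => [|m IH] [] s t st /=.
- by case: (leP t 0) => [/(le_trans st) -> | _] //; rewrite ler0n.
- by case: (leP t 0) => [/(le_trans st) -> | _] //; rewrite ler0n.
- have := IH false (s - 1) (t - 1); have := IH false (s + 1) (t + 1).
  rewrite !lerD2r => /(_ st) ? /(_ st) ?.
  have := tail_le1 false m (s - 1); have := tail_le1 false m (s + 1) => ? ?.
  rewrite lerB // lerXn2r ?nnegrE //; lra.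
- have := IH true (s - 1) (t - 1); have := IH true (s + 1) (t + 1).
  rewrite !lerD2r => /(_ st) ? /(_ st) ?.
  have := tail_ge0 true m (t - 1); have := tail_ge0 true m (t + 1) => ? ?.
  rewrite lerXn2r ?nnegrE //; lra.
Qed.

(* One round of the game, in terms of the tails at [t - 2], [t] and [t + 2]. *)
Definition round (p q r : R) : R :=
  1 - (1 - (((p + q) / 2) ^+ d + ((q + r) / 2) ^+ d) / 2) ^+ d.

Lemma le_round p q r p' q' r' :
  0 <= p <= p' -> 0 <= q <= q' -> 0 <= r <= r' -> p' <= 1 -> q' <= 1 -> r' <= 1 ->
  round p q r <= round p' q' r'.
Proof.
move=> /andP[p0 pp] /andP[q0 qq] /andP[r0 rr] p1 q1 r1.
have A : ((p + q) / 2) ^+ d <= ((p' + q') / 2) ^+ d.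
  by rewrite lerXn2r ?nnegrE; lra.
have B : ((q + r) / 2) ^+ d <= ((q' + r') / 2) ^+ d.
  by rewrite lerXn2r ?nnegrE; lra.
have A1 : ((p' + q') / 2) ^+ d <= 1 by apply: exprn_ile1; lra.
have B1 : ((q' + r') / 2) ^+ d <= 1 by apply: exprn_ile1; lra.
rewrite /round lerB // lerXn2r ?nnegrE; lra.
Qed.

Lemma tail_round m t :
  tail true m.+2 t = round (tail true m (t - 2)) (tail true m t) (tail true m (t + 2)).
Proof.
rewrite /round /= (_ : t - 1 - 1 = t - 2); last ring.
by rewrite subrK addrK (_ : t + 1 + 1 = t + 2); last ring.
Qed.

Lemma tail_round_le m t p q r : p <= 1 -> q <= 1 -> r <= 1 ->
  tail true m (t - 2) <= p -> tail true m t <= q -> tail true m (t + 2) <= r ->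
  tail true m.+2 t <= round p q r.
Proof.
by move=> p1 q1 r1 tp tq tr; rewrite tail_round le_round // ?tail_ge0 ?tail_le1.
Qed.

(** A game of [b] moves pays at most [b]. The parity bit [b] is carried along because the lower tail
    leads to games of odd length. *)
Lemma tail_start (b : bool) t : 0 < t -> tail true b (b%:R + t) = 0.
Proof.
move=> t0; case: b => /=; last by rewrite add0r leNgt t0.
rewrite !leNgt (_ : 0 < 1 + t - 1); last lra.
rewrite (_ : 0 < 1 + t + 1); last lra.
by rewrite addr0 mul0r subr0 expr1n subrr.
Qed.

Lemma le_pow_one_sub n (y : R) : 0 <= y <= 1 -> 1 - (1 - y) ^+ n <= n%:R * y.
Proof.
move=> /andP[y0 y1]; elim: n => [|n IH]; first by rewrite expr0 subrr mul0r.
have h0 : 0 <= (1 - y) ^+ n by rewrite exprn_ge0 // subr_ge0.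
have h1 : (1 - y) ^+ n <= 1 by rewrite exprn_ile1 //; lra.
rewrite exprS -natr1; nra.
Qed.

(** All three tails are at most the leftmost one, [p]. A union bound over the first moves costs the
    factor [d], and all [d] replies must succeed. *)
Lemma tail_round_power m t : tail true m.+2 t <= d%:R * tail true m (t - 2) ^+ d.
Proof.
have [p0 p1] := (tail_ge0 true m (t - 2), tail_le1 true m (t - 2)).
set p := tail true m (t - 2) in p0 p1 *.
have : tail true m.+2 t <= round p p p.
  by apply: tail_round_le => //; apply: le_tail; lra.
move/le_trans; apply; rewrite /round.
have -> : (p + p) / 2 = p by lra.
have -> : (p ^+ d + p ^+ d) / 2 = p ^+ d by lra.
by apply: le_pow_one_sub; rewrite exprn_ge0 ?exprn_ile1.
Qed.

(** Comparison principle: the initial step function lies below [psi], and the monotone [round]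
    preserves this at every site but 0, where [psi] is 1. *)
Lemma tail_barrier (psi : nat -> R) :
  psi 0 = 1 -> (forall j, 0 <= psi j <= 1) ->
  (forall j, round (psi j) (psi j.+1) (psi j.+2) <= psi j.+1) ->
  forall (b : bool) n j, tail true (b + n.*2) (b%:R + 2 * j%:R) <= psi j.
Proof.
move=> psi0 psi_itv psi_round b; elim=> [|n IH] [|j].
- by rewrite psi0 tail_le1.
- rewrite addn0 tail_start; first by case/andP: (psi_itv j.+1).
  by rewrite mulr_gt0.
- by rewrite psi0 tail_le1.
have psi1 i : psi i <= 1 by case/andP: (psi_itv i).
rewrite doubleS !addnS; apply: le_trans (psi_round j).
apply: tail_round_le => //.
  by rewrite (_ : _ - 2 = b%:R + 2 * j%:R) ?IH // -natr1; ring.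
by rewrite (_ : _ + 2 = b%:R + 2 * j.+2%:R) ?IH // -[in RHS]natr1; ring.
Qed.

(** If [p] is the tail one site to the left and one round earlier, then [d] times the new tail is at
    most [d^2 p^d <= (d p)^d], as [d >= 2]. *)
Lemma tail_decay K (b : bool) : (1 < d)%N ->
  (forall n, d%:R * tail true (b + n.*2) (b%:R + 2 * K%:R) <= 2^-1) ->
  forall n j, d%:R * tail true (b + n.*2) (b%:R + 2 * (K + j)%:R) <= 2^-1 ^+ (d ^ j).
Proof.
move=> d1 hK n j; elim: j n => [|j IH] n; first by rewrite addn0 expn0 expr1.
case: n => [|n].
  rewrite addn0 tail_start ?mulr0 ?exprn_ge0 //.
rewrite doubleS !addnS expnSr exprM.
set p := tail true (b + n.*2) (b%:R + 2 * (K + j)%:R).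
have p0 : 0 <= p by exact: tail_ge0.
have dp : d%:R * p <= 2^-1 ^+ (d ^ j) by exact: IH.
have : (d%:R * p) ^+ d <= (2^-1 ^+ (d ^ j)) ^+ d.
  by rewrite lerXn2r ?nnegrE ?mulr_ge0 ?exprn_ge0.
apply: le_trans.
have := tail_round_power (b + n.*2) (b%:R + 2 * (K + j).+1%:R).
rewrite (_ : _ - 2 = b%:R + 2 * (K + j)%:R); last by rewrite -natr1; ring.
rewrite -/p => /(ler_wpM2l (ler0n R d)) /le_trans; apply.
rewrite exprMn mulrA ler_wpM2r ?exprn_ge0 // -expr2.
by rewrite ler_weXn2l // ler1n ltnW.
Qed.

End Tail.

Arguments tail {R}.
Arguments round {R}.

(** * Upper barriers *)

Section Barrier.
Variable R : realType.
Implicit Types (b : bool) (w z : R).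

(** The barrier is 1, [x], [y] and then constantly [z]; on the constant stretch its condition
    follows from the third one by monotonicity. *)
Lemma tail_profile3 d b n (x y z : R) : 0 <= z -> z <= y -> y <= x -> x <= 1 ->
  round d 1 x y <= x -> round d x y z <= y -> round d y z z <= z ->
  tail d true (b + n.*2) (b%:R + 2 * 3%:R) <= z.
Proof.
move=> z0 zy yx x1 rx ry rz; pose psi j : R := nth z [:: 1; x; y] j.
apply: (@tail_barrier _ _ psi) => // j.
  by case: j => [|[|[|j]]]; rewrite /psi /= ?nth_nil; lra.
case: j => [|[|[|j]]]; rewrite /psi /= ?nth_nil //.
by apply: le_trans rz; apply: le_round; lra.
Qed.

(* The barriers for [d = 3] and [d = 4] were found by iterating [round d] numerically. *)
Lemma half_tail3 b n : 3 * tail 3 true (b + n.*2) (b%:R + 2 * 3%:R) <= 2^-1 :> R.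
Proof.
suff : tail 3 true (b + n.*2) (b%:R + 2 * 3%:R) <= 24^-1 :> R by lra.
by apply: (@tail_profile3 _ _ _ (11 / 12) 3^-1); rewrite /round; lra.
Qed.

Lemma half_tail4 b n : 4 * tail 4 true (b + n.*2) (b%:R + 2 * 3%:R) <= 2^-1 :> R.
Proof.
suff : tail 4 true (b + n.*2) (b%:R + 2 * 3%:R) <= 20^-1 :> R by lra.
by apply: (@tail_profile3 _ _ _ (19 / 20) 4^-1); rewrite /round; lra.
Qed.

(** The barrier 1, 1/5, 1/5, ... only yields 1/5; one more round through [tail_round_power] yields
    [d 5^-d <= 1/(2d)]. *)
Lemma half_tail_ge5 d b n : (5 <= d)%N ->
  d%:R * tail d true (b + n.*2) (b%:R + 2 * 2%:R) <= 2^-1 :> R.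
Proof.
move=> d5; pose psi j : R := if j is 0%N then 1 else 5^-1.
have psi_itv j : 0 <= psi j <= 1 by case: j => [|j] /=; lra.
(* This is [d ((3/5)^d + (1/5)^d) / 2 <= 1/5] cleared of denominators, which gives the barrier
   condition at the first site. It fails for [d = 4]. *)
have e1 : (d * (3 ^ d + 1) * 5 <= 2 * 5 ^ d)%N.
  elim: d d5 => // d IH; rewrite leq_eqVlt ltnS => /predU1P[<-|/[dup] d5 /IH] //.
  by rewrite !expnS; nia.
have e2 : (2 * (d * d) <= 5 ^ d)%N.
  elim: d d5 {e1} => // d IH; rewrite leq_eqVlt ltnS => /predU1P[<-|/[dup] d5 /IH] //.
  by rewrite !expnS; nia.
have f0 : 0 < 5^-1 ^+ d :> R by rewrite exprn_gt0 ?invr_gt0.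
have f5 : (5 : R) ^+ d * 5^-1 ^+ d = 1 by rewrite -exprMn divff ?expr1n.
have r1 : round d 1 5^-1 5^-1 <= 5^-1 :> R.
  rewrite /round; apply: le_trans (le_pow_one_sub _ _ _ _) _.
    have ? : ((1 + 5^-1) / 2) ^+ d <= 1 :> R by apply: exprn_ile1; lra.
    have ? : ((5^-1 + 5^-1) / 2) ^+ d <= 1 :> R by apply: exprn_ile1; lra.
    have ? : 0 <= ((1 + 5^-1) / 2) ^+ d :> R by apply: exprn_ge0; lra.
    have ? : 0 <= ((5^-1 + 5^-1) / 2) ^+ d :> R by apply: exprn_ge0; lra.
    lra.
  have -> : (1 + 5^-1) / 2 = 3 * 5^-1 :> R by lra.
  have -> : (5^-1 + 5^-1) / 2 = 5^-1 :> R by lra.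
  rewrite exprMn; move: e1; rewrite -(ler_nat R) !(natrM, natrD, natrX).
  move=> /(ler_wpM2r (ltW f0)); rewrite -[2 * _ * _]mulrA f5; lra.
have tail1 m : tail d true (b + m.*2) (b%:R + 2 * 1%:R) <= 5^-1 :> R.
  apply: (@tail_barrier _ _ psi) => // -[|j] //=.
  by apply: le_trans r1; apply: le_round; lra.
case: n => [|n]; first by rewrite addn0 tail_start ?mulr0 ?invr_ge0 // mulr_gt0.
rewrite doubleS !addnS.
have := @tail_round_power R d (b + n.*2) (b%:R + 2 * 2%:R).
rewrite (_ : _ - 2 = b%:R + 2 * 1%:R); last by ring.
set p := tail d true _ (_ + 2 * 1%:R).
have : p ^+ d <= 5^-1 ^+ d by rewrite lerXn2r ?nnegrE ?tail_ge0 // tail1.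
move=> pd /(ler_wpM2l (ler0n R d)) /le_trans; apply.
rewrite mulrA; have : d%:R * d%:R * p ^+ d <= d%:R * d%:R * 5^-1 ^+ d :> R.
  by rewrite ler_wpM2l ?mulr_ge0.
move: e2; rewrite -(ler_nat R) !(natrM, natrX) => /(ler_wpM2r (ltW f0)).
by rewrite f5; lra.
Qed.

(** * The moving barrier for [d = 2] *)

(* For [d = 2] the stationary profiles of [round] have the form [j |-> 1 - z j ^+ 2] with
   [z j.+1 = rise (z j)]. *)
Definition rise z : R := Num.sqrt (2 * z - z ^+ 2).

Lemma sqr_rise z : 0 <= z <= 1 -> rise z ^+ 2 = 2 * z - z ^+ 2.
Proof. by move=> z01; rewrite sqr_sqrtr //; nra. Qed.

Lemma rise_itv z : 0 <= z <= 1 -> 0 <= rise z <= 1.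
Proof.
move=> z01; rewrite sqrtr_ge0 /= -(@ler_pXn2r _ 2) ?nnegrE ?sqrtr_ge0 //.
by rewrite sqr_rise //; nra.
Qed.

Lemma iter_rise_itv n z : 0 <= z <= 1 -> 0 <= iter n rise z <= 1.
Proof. by move=> z01; elim: n => //= n; exact: rise_itv. Qed.

Lemma le_rise z z' : 0 <= z -> z <= z' -> z' <= 1 -> rise z <= rise z'.
Proof. by move=> z0 zz' z1; apply: ler_wsqrtr; nra. Qed.

Lemma le_iter_rise n z z' : 0 <= z -> z <= z' -> z' <= 1 ->
  iter n rise z <= iter n rise z'.
Proof.
move=> z0 zz' z'1; elim: n => //= n IH.
have /andP[? _] := @iter_rise_itv n z ltac:(lra).
have /andP[_ ?] := @iter_rise_itv n z' ltac:(lra).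
exact: le_rise.
Qed.

(** The graph of [rise] is a circular arc, concave with [rise 0 = 0]. Hence iterating [rise] never
    amplifies a relative loss. *)
Lemma rise_scale c z : 0 <= c <= 1 -> 0 <= z <= 1 -> c * rise z <= rise (c * z).
Proof.
move=> c01 z01; have /andP[l0 l1] := rise_itv _ z01.
have cz : 0 <= c * z <= 1 by nra.
rewrite -(@ler_pXn2r _ 2) ?nnegrE ?sqrtr_ge0 ?mulr_ge0 //; [|lra].
rewrite exprMn !sqr_rise //.
have : 0 <= c * z * (1 - c) by rewrite !mulr_ge0; lra.
lra.
Qed.

(* The stationary profile cut off at a site where [z = w] is dominated, one round later, by
   the profile cut off one site further left with [z = sink w] there. *)
Definition sink w : R := (w ^+ 2 - w ^+ 4 / 4) / 2.

Lemma sink_itv w : 0 <= w <= 1 -> 0 <= sink w <= w / 2.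
Proof.
move=> /andP[w0 w1]; rewrite /sink (exprM w 2 2).
have : 0 <= w ^+ 2 <= w by nra.
by move: (w ^+ 2) => q q01; nra.
Qed.

(** A cut that left the profile unchanged would have [rise (sink w) = w]. The lower bound limits the
    relative loss to [w^2 / 2]; the upper bound is the exact parameter that a round produces next to
    the cut. *)
Lemma rise_sink w : 0 <= w <= 1 -> w * (1 - w ^+ 2 / 2) <= rise (sink w) <= w - w ^+ 4 / 8.
Proof.
move=> w01; have h01 : 0 <= sink w <= 1 by have := sink_itv _ w01; lra.
have /andP[l0 l1] := rise_itv _ h01; have l2 := sqr_rise _ h01.
have [w0 w1] : 0 <= w /\ w <= 1 by lra.
set q := w ^+ 2; have q01 : 0 <= q <= 1 by rewrite /q; nra.
have qw : q <= w by rewrite /q; nra.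
rewrite (exprM w 2 2) -/q.
have h2 : 0 <= sink w ^+ 2 <= q ^+ 2 / 4.
  by rewrite /sink (exprM w 2 2) -/q; nra.
have l3 : rise (sink w) ^+ 2 = q - q ^+ 2 / 4 - sink w ^+ 2.
  by rewrite l2 [in 2 * _]/sink (exprM w 2 2) -/q; lra.
apply/andP; split.
  rewrite -(@ler_pXn2r _ 2) ?nnegrE ?mulr_ge0 //; last lra.
  by rewrite l3 exprMn -/q; nra.
rewrite -(@ler_pXn2r _ 2) ?nnegrE //; last nra.
have -> : (w - q ^+ 2 / 8) ^+ 2 = q - w * q ^+ 2 / 4 + q ^+ 4 / 64 by rewrite /q; lra.
have : 0 <= q ^+ 4 by rewrite exprn_ge0; lra.
by rewrite l3; nra.
Qed.

(* At time 0 the cut-off profile is the step function, that is, [z = 1] to the right of 0. *)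
Definition front n : R := iter n sink 1.

Lemma front_itv n : 0 <= front n <= 2^-1 ^+ n.
Proof.
elim: n => [|n /andP[IH0 IH1]]; first by rewrite /front /= expr0; lra.
have w1 : 2^-1 ^+ n <= 1 :> R by apply: exprn_ile1; lra.
by rewrite -[front n.+1]/(sink (front n)) exprS; have := sink_itv (front n) ltac:(lra); lra.
Qed.

Lemma front_le1 n : 0 <= front n <= 1.
Proof.
have := front_itv n; have : 2^-1 ^+ n <= 1 :> R by apply: exprn_ile1; lra.
lra.
Qed.

(** After [n] rounds the cut has moved [n] sites, so this is the profile parameter at a fixed site.
    By [rise_scale], a round costs it at most the relative loss at the cut. *)
Lemma rise_front n : 3^-1 <= iter n rise (front n).
Proof.
(* The reserve [2/3 * 4^-n] is the sum over [k >= n] of [4^-k / 2], a bound on the losses still to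
   come. *)
suff : 3^-1 + 2 / 3 * 4^-1 ^+ n <= iter n rise (front n).
  by apply: le_trans; rewrite lerDl mulr_ge0 ?exprn_ge0 ?invr_ge0.
elim: n => [|n IH]; first by rewrite /= /front /= expr0; lra.
have w01 := front_le1 n; set w := front n in w01 IH *.
have w4 : w ^+ 2 <= 4^-1 ^+ n.
  have /andP[? ?] := front_itv n.
  rewrite (_ : 4^-1 = 2^-1 ^+ 2 :> R); last lra.
  by rewrite -exprM mulnC exprM lerXn2r ?nnegrE //; lra.
have /andP[lw _] := rise_sink w w01.
have h01 : 0 <= sink w <= 1 by have := sink_itv _ w01; lra.
have c01 : 0 <= 1 - w ^+ 2 / 2 <= 1 by nra.
have : (1 - w ^+ 2 / 2) * iter n rise w <= iter n rise (rise (sink w)).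
  apply: (@le_trans _ _ (iter n rise ((1 - w ^+ 2 / 2) * w))).
    elim: (n) => //= k IHk; have wk := iter_rise_itv k w w01.
    apply: le_trans (rise_scale _ _ c01 wk) _.
    by apply: le_rise => //; have := iter_rise_itv k ((1 - w ^+ 2 / 2) * w); nra.
  apply: le_iter_rise; [nra|lra|]; by have := rise_itv _ h01; lra.
rewrite -[front n.+1]/(sink w) iterSr (exprS 4^-1); apply: le_trans.
move: (w ^+ 2) (4^-1 ^+ n) (iter n rise w) w4 c01 IH (iter_rise_itv n w w01) => q e g; nra.
Qed.

Lemma round2_stationary (z z1 z2 : R) :
  z1 ^+ 2 = 2 * z - z ^+ 2 -> z2 ^+ 2 = 2 * z1 - z1 ^+ 2 ->
  round 2 (1 - z ^+ 2) (1 - z1 ^+ 2) (1 - z2 ^+ 2) = 1 - z1 ^+ 2.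
Proof.
move=> h1 h2; rewrite /round.
have -> : (1 - z ^+ 2 + (1 - z1 ^+ 2)) / 2 = 1 - z by lra.
have -> : (1 - z1 ^+ 2 + (1 - z2 ^+ 2)) / 2 = 1 - z1 by lra.
by have -> : 1 - ((1 - z) ^+ 2 + (1 - z1) ^+ 2) / 2 = z1 by lra.
Qed.

(** The index [i] counts sites from the cut. As the cut moves, the tails at [t + 2], [t], [t - 2]
    had the indices [i], [i - 1], [i - 2] one round earlier; for negative indices the bound is 1. *)
Lemma tail2_front b n i :
  tail 2 true (b + n.*2) (b%:R + 2 * i.+1%:R - 2 * n%:R) <= 1 - iter i rise (front n) ^+ 2.
Proof.
elim: n i => [|n IH] i.
  rewrite mulr0 subr0 addn0 tail_start ?mulr_gt0 //.
  have := iter_rise_itv i (front 0) (front_le1 0); nra.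
have w01 := front_le1 n; rewrite -[front n.+1]/(sink (front n)).
set w := front n in w01 IH *.
have h01 : 0 <= sink w <= 1 by have := sink_itv _ w01; lra.
have hw : rise (sink w) <= w - w ^+ 4 / 8 by case/andP: (rise_sink _ w01).
have w4 : 0 <= w ^+ 4 by rewrite exprn_ge0; lra.
have zi j := iter_rise_itv j w w01.
have z2 j : iter j.+1 rise w ^+ 2 = 2 * iter j rise w - iter j rise w ^+ 2.
  exact: sqr_rise (zi j).
have u1 j : 1 - iter j rise w ^+ 2 <= 1 by have := zi j; nra.
set t := _ - _.
have IHp : tail 2 true (b + n.*2) (t + 2) <= 1 - iter i rise w ^+ 2.
  rewrite (_ : t + 2 = b%:R + 2 * i.+1%:R - 2 * n%:R) ?IH // /t -[n.+1%:R]natr1; ring.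
have IH0 k : i = k.+1 -> tail 2 true (b + n.*2) t <= 1 - iter k rise w ^+ 2.
  move=> ik; rewrite (_ : t = b%:R + 2 * k.+1%:R - 2 * n%:R) ?IH // /t ik.
  by rewrite -[n.+1%:R]natr1 -[k.+2%:R]natr1; ring.
have IHm k : i = k.+2 -> tail 2 true (b + n.*2) (t - 2) <= 1 - iter k rise w ^+ 2.
  move=> ik; rewrite (_ : t - 2 = b%:R + 2 * k.+1%:R - 2 * n%:R) ?IH // /t ik.
  by rewrite -[n.+1%:R]natr1 -[k.+3%:R]natr1 -[k.+2%:R]natr1; ring.
rewrite doubleS !addnS.
clearbody t; case: i IHp IH0 IHm => [|[|k]] IHp IH0 IHm.
(* This round equals [1 - sink w ^ 2] exactly, which is where the formula of [sink] comes from. *)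
- apply: (@le_trans _ _ (round 2 1 1 (1 - w ^+ 2))).
    by apply: tail_round_le; rewrite ?tail_le1 ?(u1 0).
  by rewrite /round /sink /=; nra.
(* This round equals [1 - (w - w^4 / 8)^2]. *)
- apply: (@le_trans _ _ (round 2 1 (1 - w ^+ 2) (1 - rise w ^+ 2))).
    by apply: tail_round_le; rewrite ?tail_le1 ?(u1 0) ?(u1 1%N) ?(IH0 0%N).
  rewrite /round /= sqr_rise //.
  have : rise (sink w) ^+ 2 <= (w - w ^+ 4 / 8) ^+ 2.
    have /andP[? _] := rise_itv _ h01.
    by rewrite lerXn2r ?nnegrE //; lra.
  set e := (X in _ -> 1 - X ^+ 2 <= _).
  by rewrite (_ : e = w - w ^+ 4 / 8); [lra|rewrite /e; field].
(* Away from the cut the old profile is stationary, and it lies below the new one because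
   [rise (sink w) <= w]. *)
- apply: (@le_trans _ _ (round 2 (1 - iter k rise w ^+ 2) (1 - iter k.+1 rise w ^+ 2)
    (1 - iter k.+2 rise w ^+ 2))).
    by apply: tail_round_le; rewrite ?u1 ?IHp ?IH0 ?IHm.
  rewrite (round2_stationary _ _ _ (z2 k) (z2 k.+1)) [iter k.+2 _ _]iterSr lerB //.
  have : iter k.+1 rise (rise (sink w)) <= iter k.+1 rise w.
    by apply: le_iter_rise; have := rise_itv _ h01; lra.
  have := iter_rise_itv k.+1 _ (rise_itv _ h01); have := zi k.+1.
  by move=> *; rewrite lerXn2r ?nnegrE; lra.
Qed.

Lemma half_tail2 b n : 2 * tail 2 true (b + n.*2) (b%:R + 2 * 6%:R) <= 2^-1 :> R.
Proof.
(* From 1/3 on, each [rise] shrinks the distance to 1 by the factor 2/3 or better. *)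
have z_ge k : 1 - (2 / 3) ^+ k.+1 <= iter k rise (3^-1).
  elim: k => [|k IH]; first by rewrite /= expr1; lra.
  have z01 := iter_rise_itv k 3^-1 ltac:(lra).
  have e01 : 0 <= (2 / 3 : R) ^+ k <= 1 by rewrite exprn_ge0 ?exprn_ile1; lra.
  have := rise_itv _ z01; have := sqr_rise _ z01; rewrite /= !(exprS (2 / 3)) in IH *.
  by move: (_ ^+ k) (iter k rise _) (rise _) IH z01 e01 => e z l; nra.
(* Five rises beyond the fixed site of [rise_front], the parameter is at least 7/8, and
   [1 - (7/8)^2 <= 1/4]. *)
have := tail2_front b n (n + 5).
rewrite (_ : _ - 2 * n%:R = b%:R + 2 * 6%:R); last by rewrite -addnS natrD; ring.
have : iter 5 rise 3^-1 <= iter (n + 5) rise (front n).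
  rewrite addnC iterD; apply: le_iter_rise; [lra|exact: rise_front|].
  by case/andP: (iter_rise_itv n _ (front_le1 n)).
have := iter_rise_itv (n + 5) _ (front_le1 n); have := z_ge 5%N.
have : (2 / 3) ^+ 6 <= 1 / 8 :> R by lra.
nra.
Qed.

Lemma half_tail d : (2 <= d)%N -> exists K, forall b n,
  d%:R * tail d true (b + n.*2) (b%:R + 2 * K%:R) <= 2^-1 :> R.
Proof.
case: d => [|[|[|[|[|d]]]]] // _.
- by exists 6%N => b n; exact: half_tail2.
- by exists 3%N => b n; exact: half_tail3.
- by exists 3%N => b n; exact: half_tail4.
- by exists 2%N => b n; exact: half_tail_ge5.
Qed.

End Barrier.

(** * The law of the game value *)

Definition sgn {R : realType} (s : bool) : R := if s then 1 else -1.

Section Configurations.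
Variables (R : realType) (d : nat).

(* The signs of the cookies below a vertex, down to relative depth [m]. *)
Fixpoint config (m : nat) : finType :=
  if m is m'.+1 then {ffun 'I_d -> bool * config m'} else unit.

(* [reach true m c t]: under the signs [c] the maximizer, moving first, can force a value of
   at least [t]; in [reach false m c t] the minimizer moves first. *)
Fixpoint reach (mx : bool) (m : nat) : config m -> R -> bool :=
  match m return config m -> R -> bool with
  | 0%N => fun _ t => t <= 0
  | m'.+1 => fun c t =>
      if mx then [exists i, reach false m' (c i).2 (t - sgn (c i).1)]
      else [forall i, reach true m' (c i).2 (t - sgn (c i).1)]
  end.

Lemma card_reach_step mx m t :
  #|[pred x : bool * config m | reach mx m x.2 (t - sgn x.1)]| =
  (#|[pred c | reach mx m c (t - 1)]| + #|[pred c | reach mx m c (t + 1)]|)%N.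
Proof.
rewrite -!sum1_card (eq_bigl (fun x => xpredT x.1 && reach mx m x.2 (t - sgn x.1))) //.
rewrite -(pair_big_dep xpredT (fun b c => reach mx m c (t - sgn b)) (fun _ _ => 1%N)) /=.
by rewrite big_bool /= /sgn opprK.
Qed.

Lemma card_forall_config m (Q : pred (bool * config m)) :
  #|[pred c : config m.+1 | [forall i, Q (c i)]]| = (#|Q| ^ d)%N.
Proof. by have := card_ffun_on 'I_d Q; rewrite card_ord => <-; apply: eq_card. Qed.

Lemma card_config m : #|config m.+1| = ((2 * #|config m|) ^ d)%N.
Proof. by rewrite card_ffun card_prod card_bool card_ord. Qed.

Lemma card_config_gt0 m : (0 < #|config m|)%N.
Proof.
elim: m => [|m IH]; first by rewrite card_unit.
by rewrite card_config expn_gt0 muln_gt0 IH.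
Qed.

(** A configuration is a free choice on each branch, so counts multiply and obey the recursion of
    [tail]; the maximizer's choice is counted through its complement. *)
Lemma card_reach mx m t :
  #|[pred c | reach mx m c t]|%:R = tail d mx m t * #|config m|%:R :> R.
Proof.
elim: m mx t => [|m IH] mx t.
  rewrite /= card_unit mulr1; case: (t <= 0) => /=.
    by rewrite -[#|_|]/(#|{: unit}|) card_unit.
  by rewrite eq_card0.
have hN : #|config m|%:R != 0 :> R by rewrite pnatr_eq0 -lt0n card_config_gt0.
case: mx; last first.
  rewrite [LHS](congr1 (fun n => n%:R) (card_forall_config m
    [pred x | reach true m x.2 (t - sgn x.1)])).
  rewrite card_reach_step card_config !natrX natrD !IH natrM /= -exprMn.
  by congr (_ ^+ _); field.
pose Q := [pred x : bool * config m | ~~ reach false m x.2 (t - sgn x.1)].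
have -> : #|[pred c | reach true m.+1 c t]|%:R =
    #|config m.+1|%:R - #|[pred c : config m.+1 | [forall i, Q (c i)]]|%:R :> R.
  rewrite -[#|config m.+1|](cardC [pred c | reach true m.+1 c t]) natrD.
  rewrite [X in _ + X%:R - _](_ : _ = #|[pred c : config m.+1 | [forall i, Q (c i)]]|).
    by rewrite addrK.
  by apply: eq_card => c; rewrite !inE /= negb_exists.
have cQ : #|Q|%:R = 2 * #|config m|%:R -
    (tail d false m (t - 1) + tail d false m (t + 1)) * #|config m|%:R :> R.
  rewrite (mulrDl (tail d false m _)) -!IH -natrD -card_reach_step.
  have := cardC [pred x : bool * config m | reach false m x.2 (t - sgn x.1)].
  rewrite card_prod card_bool => /(congr1 (fun n => n%:R : R)); rewrite natrD natrM => <-.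
  by rewrite [X in _ = X - _]addrC addrK.
rewrite (card_forall_config m Q) card_config !natrX natrM cQ /= mulrBl mul1r -exprMn.
by congr (_ - _ ^+ _); field.
Qed.

Fixpoint edges_below (m : nat) (v : vertex d) : seq (edge d) :=
  if m is m'.+1 then
    flatten [seq (v, i) :: edges_below m' (child v i) | i <- enum 'I_d]
  else [::].

Lemma edges_below_root m v i : (v, i) \in edges_below m.+1 v.
Proof. by apply/flatten_mapP; exists i; rewrite ?mem_enum ?mem_head. Qed.

Lemma edges_below_child m v i e :
  e \in edges_below m (child v i) -> e \in edges_below m.+1 v.
Proof. by move=> ei; apply/flatten_mapP; exists i; rewrite ?mem_enum // inE ei orbT. Qed.

Lemma edges_below_prefix m v e : e \in edges_below m v -> prefix v e.1.
Proof.
elim: m v => // m IH v /flatten_mapP[i _]; rewrite inE => /predU1P[->|/IH].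
  exact: prefix_refl.
by apply: prefix_trans; rewrite /child -cats1 prefix_prefix.
Qed.

(** The label at depth [size v] identifies the branch; this separates the branches and allows signs
    to be glued. *)
Lemma edges_below_nth m v i e i0 : e \in edges_below m (child v i) -> nth i0 e.1 (size v) = i.
Proof.
move=> /edges_below_prefix /prefixP[s ->].
by rewrite /child -cats1 -catA nth_cat ltnn subnn.
Qed.

Lemma edges_below_neq m v i e : e \in edges_below m (child v i) -> e.1 != v.
Proof.
move=> /edges_below_prefix /prefixP[s es]; apply/eqP => /(congr1 size).
by rewrite es size_cat size_rcons; lia.
Qed.

Lemma uniq_edges_below m v : uniq (edges_below m v).
Proof.
elim: m v => // m IH v /=.
have : uniq (enum 'I_d) by exact: enum_uniq.
elim: (enum 'I_d) => //= i s IHs /andP[ins us].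
rewrite cat_uniq IH IHs //= andbT mem_cat negb_or.
have -> /= : (v, i) \notin edges_below m (child v i).
  by apply/negP => /edges_below_neq; rewrite eqxx.
apply/andP; split.
  apply/negP => /flatten_mapP[j js]; rewrite inE.
  case/predU1P=> [[ij]|/edges_below_neq]; last by rewrite eqxx.
  by rewrite ij js in ins.
apply/hasPn => e /flatten_mapP[j js]; rewrite inE => /predU1P[->|ej].
  by apply/negP => /edges_below_neq; rewrite eqxx.
apply/negP => ei; move: ins.
rewrite -(edges_below_nth _ _ _ _ i ei) (edges_below_nth _ _ _ _ i ej).
by rewrite js.
Qed.

Lemma card_edges_below m v : #|config m| = (2 ^ size (edges_below m v))%N.
Proof.
elim: m v => [|m IH] v; first by rewrite card_unit.
rewrite card_config /= size_flatten /shape -map_comp sumnE big_map big_enum /=.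
rewrite (eq_bigr (fun=> (size (edges_below m v)).+1)).
  by rewrite sum_nat_const card_ord (mulnC d) expnM expnS -IH.
move=> i _; congr _.+1; apply/eqP; rewrite -(@eqn_exp2l 2) //.
by rewrite -!IH.
Qed.

Fixpoint config_of (s : edge d -> bool) (m : nat) (v : vertex d) : config m :=
  match m return config m with
  | 0%N => tt
  | m'.+1 => [ffun i => (s (v, i), config_of s m' (child v i))]
  end.

Lemma eq_config_of s s' m v : {in edges_below m v, s =1 s'} ->
  config_of s m v = config_of s' m v.
Proof.
elim: m v => //= m IH v ss'; apply/ffunP => i; rewrite !ffunE.
by congr (_, _); [apply/ss'/edges_below_root|apply/IH => e /edges_below_child; exact: ss'].
Qed.

Lemma config_of_inj s s' m v : config_of s m v = config_of s' m v ->
  {in edges_below m v, s =1 s'}.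
Proof.
elim: m v => //= m IH v /ffunP ss' e /flatten_mapP[i _].
have := ss' i; rewrite !ffunE => -[si ci]; rewrite inE => /predU1P[->//|]; exact: IH.
Qed.

Lemma config_of_surj m v (c : config m) : exists s, config_of s m v = c.
Proof.
elim: m v c => [v []|m IH v c]; first by exists xpredT.
have [s hs] := choice (fun i => IH (child v i) (c i).2).
exists (fun e => if e.1 == v then (c e.2).1 else s (nth e.2 e.1 (size v)) e).
apply/ffunP => i; rewrite ffunE /= eqxx [RHS]surjective_pairing; congr (_, _).
rewrite -hs; apply: eq_config_of => e ei.
by rewrite (negbTE (edges_below_neq _ _ _ _ ei)) (edges_below_nth _ _ _ _ _ ei).
Qed.

End Configurations.

Arguments reach {R d}.
Arguments edges_below {d}.
Arguments config_of {d}.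

(** * Game values and forced outcomes *)

Section Reach.
Variables (R : realType) (d : nat).
Hypothesis d_gt0 : (0 < d)%N.

Lemma le_max_over (F : 'I_d -> R) t : (t <= max_over F) = [exists i, t <= F i].
Proof.
have [[i Fi] le_F] := max_overP F d_gt0.
by apply/idP/existsP => [|[j /le_trans]]; [rewrite Fi; exists i|apply].
Qed.

Lemma max_over_le (F : 'I_d -> R) t : (max_over F <= t) = [forall i, F i <= t].
Proof.
have [[i Fi] le_F] := max_overP F d_gt0.
by apply/idP/forallP => [h j|]; [exact: le_trans h|rewrite Fi].
Qed.

Lemma min_over_le (F : 'I_d -> R) t : (min_over F <= t) = [exists i, F i <= t].
Proof.
have [[i Fi] le_F] := min_overP F d_gt0.
apply/idP/existsP => [|[j Fj]]; [rewrite Fi; by exists i|exact: le_trans Fj].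
Qed.

Lemma le_min_over (F : 'I_d -> R) t : (t <= min_over F) = [forall i, t <= F i].
Proof.
have [[i Fi] le_F] := min_overP F d_gt0.
by apply/idP/forallP => [h j|]; [exact: le_trans (le_F j)|rewrite Fi].
Qed.

Lemma value_ge_reach (x : edge d -> R) s m v t :
  {in edges_below m v, forall e, x e = sgn (s e)} ->
  (t <= value_rec x m v) = reach (~~ odd (height v)) m (config_of s m v) t.
Proof.
elim: m v t => //= m IH v t xs.
have step i : (t <= x (v, i) + value_rec x m (child v i)) =
    reach (odd (height v)) m (config_of s m (child v i)) (t - sgn (s (v, i))).
  rewrite -lerBlDl xs ?edges_below_root // IH; last first.
    by move=> e ei; apply: xs; exact: edges_below_child ei.
  by rewrite /child /height size_rcons /= negbK.
case: (odd _) step => step /=; rewrite ?le_max_over ?le_min_over.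
  by apply: eq_forallb => i; rewrite ffunE step.
by apply: eq_existsb => i; rewrite ffunE step.
Qed.

(* Negating all cookies exchanges the two players. *)
Lemma value_le_reach (x : edge d -> R) s m v t :
  {in edges_below m v, forall e, x e = - sgn (s e)} ->
  (value_rec x m v <= - t) = reach (odd (height v)) m (config_of s m v) t.
Proof.
elim: m v t => [|m IH] v t xs /=; first by rewrite oppr_ge0.
have step i : (x (v, i) + value_rec x m (child v i) <= - t) =
    reach (~~ odd (height v)) m (config_of s m (child v i)) (t - sgn (s (v, i))).
  rewrite -lerBrDl xs ?edges_below_root //.
  rewrite (_ : - t - _ = - (t - sgn (s (v, i)))); last by ring.
  rewrite IH; last by move=> e ei; apply: xs; exact: edges_below_child ei.
  by rewrite /child /height size_rcons.
case: (odd _) step => step /=; rewrite ?max_over_le ?min_over_le.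
  by apply: eq_existsb => i; rewrite ffunE step.
by apply: eq_forallb => i; rewrite ffunE step.
Qed.

End Reach.

(** * From counting configurations to probabilities *)

Section Law.
Context (R : realType) (dT : measure_display) (T : measurableType dT).
Variable P : probability T R.

Lemma le_measure_bigsetU (I : Type) (s : seq I) (Q : pred I) (A : I -> set T) :
  (forall i, measurable (A i)) ->
  (P (\big[setU/set0]_(i <- s | Q i) A i) <= \sum_(i <- s | Q i) P (A i))%E.
Proof.
move=> mA; elim: s => [|i s IH]; first by rewrite !big_nil measure0.
rewrite !big_cons; case: ifP => // _.
apply: (le_trans (measureU2 _ _ _)) => //; first exact: bigsetU_measurable.
exact: leeD2l.
Qed.

Variables (d : nat) (X : edge d -> {RV P >-> R}).
Hypotheses (indep : mutually_independent X).
Hypothesis unif : forall e, uniform_sign (X e).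

Lemma prob_sign e (o : bool) : P (X e @^-1` [set sgn o]) = (2^-1)%:E.
Proof. by case: o; [exact: (unif e).1|exact: (unif e).2]. Qed.

Lemma measurable_sign e (A : set R) : measurable A -> measurable (X e @^-1` A).
Proof. by move=> mA; rewrite -[_ @^-1` _]setTI; exact: measurable_funP. Qed.

Lemma prob_not_sign e : P (~` (X e @^-1` [set 1] `|` X e @^-1` [set -1])) = 0%E.
Proof.
have m1 := measurable_sign e _ (measurable_set1 (1 : R)).
have m2 := measurable_sign e _ (measurable_set1 (-1 : R)).
rewrite probability_setC; last exact: measurableU.
rewrite measureU //.
  transitivity (1 - ((2^-1)%:E + (2^-1)%:E) : \bar R)%E.
    by congr (1 - (_ + _))%E; [exact: (unif e).1|exact: (unif e).2].
  by apply: (congr1 EFin (_ : 1 - (2^-1 + 2^-1) = 0 :> R)); lra.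
by apply/seteqP; split => // w [/= -> ]; lra.
Qed.

(** Up to a null event, [B] is covered by the cylinders of the configurations counted in
    [card_reach], each of probability [1 / #|config d m|]. With [o = false] all signs are read
    reversed, which serves the lower tail. *)
Lemma le_tail_prob (B : set T) o mx m v t : measurable B ->
  (forall w s, {in edges_below m v, forall e, X e w = sgn (s e == o)} ->
    B w -> reach mx m (config_of s m v) t) ->
  (P B <= (tail d mx m t)%:E)%E.
Proof.
move=> mB hB; have [S hS] := choice (config_of_surj d m v).
pose A c e := X e @^-1` [set sgn (S c e == o) : R].
pose E c := \bigcap_(e in [set` edges_below m v]) A c e.
have mA c e : measurable (A c e) by exact: measurable_sign.
have mE c : measurable (E c) by apply: fin_bigcap_measurable => //.
have PE c : P (E c) = (#|config d m|%:R^-1)%:E.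
  rewrite indep ?uniq_edges_below //.
  under eq_bigr do rewrite prob_sign.
  rewrite prodEFin big_const_seq count_predT (card_edges_below d m v).
  by rewrite iter_mulr_1 natrX exprVn.
pose N := \big[setU/set0]_(e <- edges_below m v)
  ~` (X e @^-1` [set 1] `|` X e @^-1` [set -1]).
have mN0 e : measurable (~` (X e @^-1` [set 1] `|` X e @^-1` [set (-1 : R)])).
  by apply/measurableC/measurableU; exact: measurable_sign.
have mN : measurable N by exact: bigsetU_measurable.
have PN : P N = 0%E.
  apply/eqP; rewrite eq_le measure_ge0 andbT.
  apply: (le_trans (le_measure_bigsetU _ _ _ _ mN0)).
  by rewrite big1 // => e _; exact: prob_not_sign.
pose U := \big[setU/set0]_(c : config d m | reach mx m c t) E c.
have mU : measurable U by exact: bigsetU_measurable.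
have BU : B `<=` U `|` N.
  move=> w Bw; have [|NNw] := pselect (N w); first by right.
  left; pose s e := (X e w == 1) == o.
  have sP : {in edges_below m v, forall e, X e w = sgn (s e == o)}.
    move=> e em; have : (X e @^-1` [set 1] `|` X e @^-1` [set -1]) w.
      by apply: contrapT => h; apply: NNw; rewrite /N -bigcup_seq; exists e.
    have -> : (s e == o) = (X e w == 1) by rewrite /s; case: (_ == 1); case: (o).
    move=> -[/= ->|/= ->]; first by rewrite eqxx.
    by rewrite /sgn lt_eqF //; lra.
  rewrite /U -(bigcup_pred (fun c => reach mx m c t)).
  exists (config_of s m v); first exact: hB sP Bw.
  move=> e em; apply: (etrans (sP e em)); congr (sgn (_ == o)).
  by have := config_of_inj d _ _ m v (hS (config_of s m v)) e em => ->.
apply: (@le_trans _ _ (P (U `|` N))).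
  by apply: le_measure; rewrite ?inE //; exact: measurableU.
apply: (le_trans (measureU2 _ _ _)) => //; rewrite [X in (_ + X)%E]PN adde0.
apply: (le_trans (le_measure_bigsetU _ _ _ _ mE)).
under eq_bigr do rewrite PE.
rewrite sumEFin lee_fin sumr_const -[_ *+ _]mulr_natl.
rewrite (card_reach R d mx m t) mulfK // pnatr_eq0 -lt0n.
exact: card_config_gt0.
Qed.

End Law.

(** * Two-sided tail bound for the game value *)

Section Tails.
Context (R : realType) (dT : measure_display) (T : measurableType dT).
Variable P : probability T R.
Variables (d : nat) (X : edge d -> {RV P >-> R}).
Hypotheses (d_ge2 : (2 <= d)%N) (indep : mutually_independent X).
Hypothesis unif : forall e, uniform_sign (X e).

Let d_gt0 : (0 < d)%N := ltnW d_ge2.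

Lemma measurable_V_ge n t : measurable [set w | t <= V X n w].
Proof.
rewrite (_ : mkset _ = V X n @^-1` [set` `[t, +oo[]); first exact: measurable_funPTI.
by apply/seteqP; split => w; rewrite /= in_itv /= andbT.
Qed.

Lemma measurable_V_le n t : measurable [set w | V X n w <= t].
Proof.
rewrite (_ : mkset _ = V X n @^-1` [set` `]-oo, t]]); first exact: measurable_funPTI.
by apply/seteqP; split => w; rewrite /= in_itv /=.
Qed.

Lemma prob_V_ge n t : (P [set w | t <= V X n w]%R <= (tail d true (n.*2) t)%:E)%E.
Proof.
apply: (le_tail_prob _ _ _ _ _ _ indep unif _ true _ _ [::] _ (measurable_V_ge _ _)) => w s Xs.
rewrite /= /V /= /game_value /value_at subn0 mul2n (value_ge_reach _ _ d_gt0 _ s) //.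
by move=> e em; rewrite Xs // eqb_id.
Qed.

Lemma prob_V_le n t : (P [set w | V X n w <= - t]%R <= (tail d false (n.*2) t)%:E)%E.
Proof.
apply: (le_tail_prob _ _ _ _ _ _ indep unif _ false _ _ [::] _ (measurable_V_le _ _)) => w s Xs.
rewrite /= /V /= /game_value /value_at subn0 mul2n (value_le_reach _ _ d_gt0 _ s) //.
by move=> e em; rewrite Xs // /sgn eqbF_neg; case: (s e); rewrite ?opprK.
Qed.

(** Keep only one of the minimizer's first moves and grant the cookie +1 on it. *)
Lemma tail_min_max m (t : R) : tail d false m.+1 t <= tail d true m (t - 1).
Proof.
have ? := tail_ge0 R d true m (t + 1); have ? := tail_ge0 R d true m (t - 1).
have ? := tail_le1 R d true m (t - 1).
have ? : tail d true m (t + 1) <= tail d true m (t - 1) by apply: le_tail; lra.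
rewrite /=; set p := (_ + _) / 2.
have : p ^+ d <= p ^+ 1 by apply: ler_wiXn2l => //; rewrite /p; lra.
by rewrite expr1 /p; lra.
Qed.

Lemma V_abs_ge n t : [set w | t <= `|V X n w|] =
  [set w | t <= V X n w] `|` [set w | V X n w <= - t].
Proof.
apply/seteqP; split => w /=; rewrite lerNr ler_normr; first by case/orP; [left|right].
by case => ->; rewrite ?orbT.
Qed.

Lemma prob_V_abs : exists K, forall n j, (1 <= n)%N ->
  (P [set w | (2 * (K + j))%:R <= `|V X n w|]%R <= (2^-1 ^+ (d ^ j))%:E)%E.
Proof.
have [K hK] := half_tail R d d_ge2; exists K.+1 => -[//|n] j _.
set t : R := (2 * _)%:R.
have tE : t = 2 * (K + j)%:R + 2 by rewrite /t addSn natrM -natr1; ring.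
rewrite V_abs_ge.
apply: (le_trans (measureU2 _ _ _)); [exact: measurable_V_ge|exact: measurable_V_le|].
apply: (le_trans (leeD (prob_V_ge _ _) (prob_V_le _ _))).
rewrite -EFinD lee_fin doubleS.
have dK b m i := @tail_decay R d K b d_ge2 (hK b) m i.
have := dK true n j; have := dK false n.+1 j.+1.
rewrite !add0r add0n doubleS (_ : 2 * (K + j.+1)%:R = t); last first.
  by rewrite tE addnS -natr1; ring.
have := tail_min_max (n.*2).+1 t; rewrite (_ : t - 1 = true%:R + 2 * (K + j)%:R); last first.
  by rewrite tE -[true%:R]/(1 : R); ring.
rewrite -[(true + _)%N]/(n.*2.+1).
have : 2^-1 ^+ (d ^ j.+1) <= 2^-1 ^+ (d ^ j) :> R.
  by apply: ler_wiXn2l; rewrite ?leq_exp2l //; lra.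
(* The factor [d >= 2] in [tail_decay] pays for adding the upper and the lower tail. *)
have half x : 0 <= x -> 2 * x <= d%:R * x :> R.
  by move=> x0; rewrite ler_wpM2r // ler_nat.
have := half _ (tail_ge0 R d true n.*2.+1 (true%:R + 2 * (K + j)%:R)).
have := half _ (tail_ge0 R d true n.*2.+2 t).
lra.
Qed.

End Tails.

Theorem theorem1p1 (R : realType) (dT : measure_display)
    (T : measurableType dT) (P : probability T R) (d : nat)
    (X : edge d -> {RV P >-> R}) :
  (2 <= d)%N ->
  mutually_independent X ->
  (forall e, uniform_sign (X e)) ->
  tight [set n | (1 <= n)%N] (V X) /\
  exists2 c : R, 0 < c &
    \forall k \near \oo,
      (ereal_sup [set P [set w | ((2 * k)%:R <= `|V X n w|)%R] |
                   n in [set n | (1 <= n)%N]]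
       <= (expR (- c * (d ^ k)%:R))%:E)%E.
Proof.
move=> d_ge2 indep unif.
have [K hK] := prob_V_abs _ _ _ _ _ _ d_ge2 indep unif; split.
  (* This choice gives [2^j > j >= 1/eps], hence [2^-(d^j) <= 2^-j <= eps]. *)
  move=> eps eps0; pose j := Num.bound eps^-1.
  have epsj : 2^-1 ^+ (d ^ j) <= eps.
    apply: (@le_trans _ _ (2^-1 ^+ j)).
      by apply: ler_wiXn2l; [lra|lra|exact/ltnW/ltn_expl].
    rewrite exprVn invf_ple ?posrE ?exprn_gt0 //.
    have := archi_boundP (ltW (_ : 0 < eps^-1)); rewrite invr_gt0 => /(_ eps0).
    move/ltW/le_trans; apply; rewrite -natrX ler_nat; exact/ltnW/ltn_expl.
  exists [set` `[- (2 * (K + j))%:R, (2 * (K + j))%:R]]; split; first exact: segment_compact.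
  move=> n n1; rewrite /distribution /pushforward.
  set L : R := (2 * _)%:R; set B := _ @^-1` _.
  have mB : measurable B by exact: measurable_funPTI.
  have mC : measurable [set w | L <= `|V X n w|].
    rewrite V_abs_ge.
    by apply: measurableU; [exact: measurable_V_ge|exact: measurable_V_le].
  have : (P (~` B) <= eps%:E)%E.
    apply: (@le_trans _ _ (P [set w | L <= `|V X n w|]%R)).
      apply: le_measure; rewrite ?inE //; first exact: measurableC.
      move=> w /= /negP; rewrite /= in_itv /= -ler_norml -ltNge; exact: ltW.
    by apply: le_trans (hK n j n1) _; rewrite lee_fin.
  rewrite probability_setC // -(fineK (fin_num_measure P B mB)) -EFinB !lee_fin; lra.
(* With this constant the bound at [k] is exactly [2^-(d^(k - K))]. *)
exists (ln 2 / (d ^ K)%:R).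
  by rewrite divr_gt0 ?ltr0n ?expn_gt0 ?(ltnW d_ge2) // ln_gt0 // ltr1n.
exists K => // k /= Kk; apply: ge_ereal_sup => _ [n n1 <-].
rewrite -(subnKC Kk); apply: le_trans (hK n (k - K)%N n1) _; rewrite lee_fin.
rewrite expnD natrM mulNr mulrA divfK; last by rewrite pnatr_eq0 -lt0n expn_gt0 (ltnW d_ge2).
by rewrite expRN mulrC expRM_natl lnK ?posrE // exprVn.
Qed.
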